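(* Let $k\ge1$ and let $\mathbf n=(n_i)_{i\in[k]}$ be a vector of positive integers. Let $\delta>0$ be the solution of $\delta=\sqrt{32\log(k/\delta)/\min_i n_i}$, and let $\beta_\delta=\sqrt{2\log(k/\delta)}$. For $\alpha\in\mathbb R$ let $\mathcal I(\alpha)$ be the confidence-adjusted index algorithm with parameter $\alpha$, i.e. the algorithm that selects an arm in $\arg\max_{i\in[k]}\hat\mu_i+\alpha/\sqrt{n_i}$. Then, for any $\alpha\in[-\beta_\delta,\beta_\delta]$, $$\sup_{\theta\in\Theta_{\mathbf n}}\mathcal R(\mathcal I(\alpha),\theta)\ \le\ 12\sqrt{\frac{\log(k/\delta)}{\min_i n_i}}.$$
   Context: Batch bandit setting: there are $k$ arms, $[k]=\{1,\dots,k\}$. For each arm $i$ there are $n_i\ge 1$ i.i.d. observations $X_{i,1},\dots,X_{i,n_i}\sim P_i$, and all observations $X=(X_{i,j})$ are independent. An instance is $\theta=((n_i)_{i\in[k]},(P_i)_{i\in[k]})$, where each $P_i$ is 1-subgaussian (that is, $\mathbb E_{Y\sim P_i}[e^{\lambda(Y-\mu_i)}]\le e^{\lambda^2/2}$ for all $\lambda\in\mathbb R$) with mean $\mu_i\in[0,1]$. $\Theta_{\mathbf n}$ is the set of all such instances with counts $\mathbf n$ fixed. The empirical mean of arm $i$ is $\hat\mu_i=\frac1{n_i}\sum_{j=1}^{n_i}X_{i,j}$. An algorithm $\mathcal A$ takes the counts and the data $X$ and returns an arm $\mathcal A(X)\in[k]$. With $\mu^*=\max_i\mu_i$, its simple regret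 is $\mathcal R(\mathcal A,\theta)=\mu^*-\mathbb E_{X\sim\theta}[\mu_{\mathcal A(X)}]$. Ties in the argmax are broken arbitrarily. *)

(* Defs.v *)
(* MathComp-Analysis; the reals are an arbitrary R : realType. *)
From HB Require Import structures.
From mathcomp Require Import all_boot all_order all_algebra.
From mathcomp Require Import all_classical all_reals all_analysis.

Set Implicit Arguments.
Unset Strict Implicit.
Unset Printing Implicit Defensive.

Import Order.TTheory GRing.Theory Num.Theory.
Import numFieldNormedType.Exports.

Local Open Scope classical_set_scope.
Local Open Scope ring_scope.

Section product_probability.
Context d (T : measurableType d) (R : realType).

Definition tuple_cons (N : nat) (x : T * N.-tuple T) : N.+1.-tuple T :=
  [tuple of x.1 :: x.2].

Lemma measurable_tuple_cons N : measurable_fun setT (@tuple_cons N).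
Proof. exact: (measurable_cons measurable_fst measurable_snd). Qed.

HB.instance Definition _ N := @isMeasurableFun.Build _ _ _ _
  (@tuple_cons N) (@measurable_tuple_cons N).

(* The law of N independent variables with marginals Q 0, ..., Q (N-1), built
   from the binary product; it is characterised by product_probE below. *)
Fixpoint product_prob (N : nat) :
    ('I_N -> probability T R) -> probability (N.-tuple T) R :=
  match N with
  | 0 => fun _ => \d_([tuple] : 0.-tuple T)
  | N'.+1 => fun Q => distribution
      (Q ord0 \x product_prob (fun l => Q (lift ord0 l)))%E (@tuple_cons N')
  end.

Lemma product_probE N (Q : 'I_N -> probability T R) (A : 'I_N -> set T) :
  (forall l, measurable (A l)) ->
  product_prob Q [set x | forall l, A l (tnth x l)] =
  (\prod_(l < N) Q l (A l))%E.
Proof.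
elim: N Q A => [|N IHN] Q A mA.
  rewrite big_ord0 /= (_ : [set x | _] = setT) ?diracT//.
  by apply/seteqP; split => // x _ [].
rewrite big_ord_recl /= /distribution /pushforward /=.
pose B := [set x : N.-tuple T | forall l, A (lift ord0 l) (tnth x l)].
have mB : measurable B.
  rewrite (_ : B = \bigcap_(l in [set: 'I_N])
      ((@tnth N T)^~ l @^-1` A (lift ord0 l))); last first.
    by apply/seteqP; split => x /= h l; [move=> _|]; exact: h.
  apply: fin_bigcap_measurable => // l _; rewrite -[X in measurable X]setTI.
  exact: measurable_tnth.
rewrite -(IHN _ (fun l => A (lift ord0 l)))// -product_measure1E//.
congr ((_ \x _)%E _); apply/seteqP; split => [[x t] h|[x t] [h1 h2] l].
  split; first exact: (h ord0).
  by move=> l; have := h (lift ord0 l); rewrite /= tnthS.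
rewrite /tuple_cons /=; case: (unliftP ord0 l) => [l' ->|->//].
by rewrite tnthS; exact: h2.
Qed.

End product_probability.

Section bandit.
Variables (R : realType) (k : nat).

Definition mean (P : probability R R) : R := fine 'E_P[idfun].

Definition subgaussian1 (P : probability R R) : Prop :=
  forall t : R, ('M_P (fun y : R => y - mean P)%R t <= (expR (t ^+ 2 / 2))%:E)%E.

(* 'E is total, so the existence of the mean is a separate condition. *)
Definition admissible (P : probability R R) : Prop :=
  [/\ P.-integrable setT (EFin \o idfun), 0 <= mean P <= 1 & subgaussian1 P].

Record bandit_instance := BanditInstance {
  counts : 'I_k -> nat;
  arm_law : 'I_k -> probability R R
}.

Definition Theta (n : 'I_k -> nat) : set bandit_instance :=
  [set theta | [/\ counts theta = n, forall i, (1 <= counts theta i)%N &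
                   forall i, admissible (arm_law theta i)]].

(* The observations are indexed by the pairs (i, j) with j < n i. *)
Definition obs (n : 'I_k -> nat) : finType := {i : 'I_k & 'I_(n i)}.

Local Notation data n := (#|obs n|.-tuple R).

Definition sample n (x : data n) (i : 'I_k) (j : 'I_(n i)) : R :=
  tnth x (enum_rank (Tagged (fun i => 'I_(n i)) j : obs n)).

Definition data_law (theta : bandit_instance) :
    probability (data (counts theta)) R :=
  product_prob
    (fun l => arm_law theta (tag (enum_val l : obs (counts theta)))).

Definition emp_mean n (x : data n) (i : 'I_k) : R :=
  (n i)%:R^-1 * \sum_(j < n i) sample x j.

(* Measurability in the data is what makes the expected regret meaningful. *)
Record algorithm := Algorithm {
  select :> forall n : 'I_k -> nat, data n -> 'I_k;
  measurable_select : forall n i, measurable (select (n := n) @^-1` [set i])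
}.

Definition arm_mean (theta : bandit_instance) (i : 'I_k) : R :=
  mean (arm_law theta i).

(* The unit 0 of the maximum is harmless: means lie in [0, 1] on Theta n. *)
Definition best_mean (theta : bandit_instance) : R :=
  \big[Num.max/0]_(i < k) arm_mean theta i.

Definition simple_regret (A : algorithm) (theta : bandit_instance) : \bar R :=
  ((best_mean theta)%:E
   - 'E_(data_law theta)[fun x => arm_mean theta (A _ x)])%E.

Definition conf_index (alpha : R) n (x : data n) (i : 'I_k) : R :=
  emp_mean x i + alpha / Num.sqrt (n i)%:R.

(* A maximises the index; which maximiser it selects is unconstrained. *)
Definition index_algorithm (alpha : R) (A : algorithm) : Prop :=
  forall (n : 'I_k -> nat) (x : data n), (forall i, (1 <= n i)%N) ->
    forall i, conf_index alpha x i <= conf_index alpha x (A n x).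

End bandit.

(* For k > 0 the unit of the minimum is absorbed. *)
Definition min_count k (n : 'I_k -> nat) : nat :=
  \big[minn/(\max_(i < k) n i)%N]_(i < k) n i.

(* Main.v *)
(* Let i0 be an optimal arm, beta = sqrt (2 ln (k / delta)) and m = min n.
   Chernoff's bound for the sum of the observations of one arm, whose moment
   generating function factors over the product law, bounds by delta / k the
   probability that its empirical mean deviates on a given side by at least
   beta / sqrt (n i).  If i0 is not underestimated and no other arm is
   overestimated by that much, the selected arm a satisfies
     mu i0 - mu a <= (beta - alpha) / sqrt (n i0) + (beta + alpha) / sqrt (n a)
                  <= 2 beta / sqrt m = delta / 2,
   both coefficients being nonnegative.  Otherwise the regret is at most 1, and
   this happens with probability at most k (delta / k).  The total 3/2 delta is
   below 12 sqrt (ln (k / delta) / m), as delta is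
   sqrt 32 times sqrt (ln (k / delta) / m). *)
Require Import Defs.
From HB Require Import structures.
From mathcomp Require Import all_boot all_order all_algebra.
From mathcomp Require Import all_classical all_reals all_analysis.
From mathcomp Require Import measurable_realfun ring lra.

Import Order.TTheory GRing.Theory Num.Theory.
Import numFieldNormedType.Exports.
Local Open Scope classical_set_scope.
Local Open Scope ring_scope.

(** Tonelli, by induction on [N]. Nonnegativity stands in for integrability, so the lemma applies to
    exponentials before their integrals are known to be finite. *)
Lemma integral_product_prob d (T : measurableType d) (R : realType) (N : nat)
    (Q : 'I_N -> probability T R) (f : 'I_N -> T -> R) :
  (forall l, measurable_fun setT (f l)) -> (forall l y, 0 <= f l y) ->
  (\int[product_prob Q]_x (\prod_(l < N) f l (tnth x l))%:E =
   \prod_(l < N) \int[Q l]_y (f l y)%:E)%E.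
Proof.
have mprod M (g : 'I_M -> T -> R) : (forall l, measurable_fun setT (g l)) ->
    measurable_fun setT (fun x : M.-tuple T => \prod_(l < M) g l (tnth x l)).
  move=> mg; apply: measurable_prod => l _.
  exact: measurableT_comp (mg l) (measurable_tnth l).
elim: N Q f => [|N IHN] Q f mf f0.
  rewrite big_ord0 /= integral_dirac//; last first.
    by apply/measurable_EFinP; exact: mprod 0%N f mf.
  by rewrite diracT mul1e big_ord0.
rewrite big_ord_recl -(IHN (fun l => Q (lift ord0 l)))//=.
rewrite -ge0_integralZr//; first last.
- by apply: integral_ge0 => x _; rewrite lee_fin; apply: prodr_ge0.
- by move=> y _; rewrite lee_fin.
- exact/measurable_EFinP.
rewrite ge0_integral_distribution//; first last.
- by move=> x; rewrite lee_fin; apply: prodr_ge0.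
- by apply/measurable_EFinP; exact: mprod N.+1 f mf.
rewrite fubini_tonelli1//; first last.
- by move=> x /=; rewrite lee_fin; apply: prodr_ge0.
- apply/measurable_EFinP.
  exact: measurableT_comp (mprod N.+1 f mf) (@measurable_tuple_cons _ T N).
apply: eq_integral => y _.
rewrite -ge0_integralZl//; first last.
- by rewrite lee_fin.
- by move=> x _; rewrite lee_fin; apply: prodr_ge0.
- apply/measurable_EFinP.
  by apply: (mprod N (fun l => f (lift ord0 l))) => l; exact: mf.
apply: eq_integral => x _ /=.
rewrite -EFinM big_ord_recl; congr ((_ * _)%:E).
by apply: eq_bigr => l _; rewrite tnthS.
Qed.

(** The data form one flat tuple; this isolates the positions of one arm. The operation is general
    because both real and extended real products are regrouped. *)
Lemma big_obs (R : Type) (idx : R) (op : Monoid.com_law idx) k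
    (n : 'I_k -> nat) (F : 'I_#|obs n| -> R) (i : 'I_k) :
  \big[op/idx]_(l < #|obs n| | tag (enum_val l : obs n) == i) F l =
  \big[op/idx]_(j < n i)
    F (enum_rank (Tagged (fun i => 'I_(n i)) j : obs n)).
Proof.
rewrite (reindex (@enum_rank (obs n))) /=; last first.
  by apply: onW_bij; exact: enum_rank_bij.
under eq_bigl do rewrite enum_rankK.
pose G i (j : 'I_(n i)) :=
  F (enum_rank (Tagged (fun i => 'I_(n i)) j : obs n)).
transitivity (\big[op/idx]_(i' | i' == i) \big[op/idx]_(j < n i') G i' j).
  rewrite (@sig_big_dep _ _ op 'I_k (fun i => 'I_(n i)) (fun i' => i' == i)
    (fun _ _ => true) G).
  by apply: eq_big => [[i' j]|[i' j]]/=; rewrite ?andbT.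
by rewrite big_pred1_eq.
Qed.

Lemma min_count_le k (n : 'I_k -> nat) (i : 'I_k) : (min_count n <= n i)%N.
Proof.
rewrite /min_count -[X in (X <= _)%N]/(\big[Order.min/_]_(i < k) n i).
by rewrite -leEnat bigmin_le.
Qed.

Lemma measurable_emp_dev (R : realType) k (n : 'I_k -> nat) (i : 'I_k)
    (s m : R) :
  measurable_fun setT
    (fun x : #|obs n|.-tuple R => s * (emp_mean x i - m)).
Proof.
apply: measurable_funM => //; apply: measurable_funB => //.
apply: measurable_funM => //; apply: measurable_sum => j.
exact: measurable_tnth.
Qed.

Lemma emp_mean_sub (R : realType) k (n : 'I_k -> nat) (i : 'I_k)
    (x : #|obs n|.-tuple R) (m : R) : (1 <= n i)%N ->
  \sum_(j < n i) (sample x j - m) = (n i)%:R * (emp_mean x i - m).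
Proof.
move=> n1; have n0 : (n i)%:R != 0 :> R by rewrite pnatr_eq0 -lt0n.
rewrite big_split /= sumr_const card_ord /emp_mean mulrBr mulrA divff// mul1r.
by rewrite -[RHS]/(_ - _) mulr_natl mulNrn.
Qed.

(** The sign [s] treats both tails at once: the moment bound depends on it only through [s ^+ 2]. *)
Lemma emp_mean_tail (R : realType) k (theta : bandit_instance R k) (i : 'I_k)
    (s c : R) :
  (1 <= counts theta i)%N -> subgaussian1 (arm_law theta i) ->
  s ^+ 2 = 1 -> 0 < c ->
  (data_law theta
     [set x | (c <= s * (emp_mean x i - arm_mean theta i))%R] <=
   (expR (- ((counts theta i)%:R * c ^+ 2 / 2)))%:E)%E.
Proof.
case: theta => n Q; rewrite /arm_mean /= => n1 sg s2 c0.
have N0 : 0 < (n i)%:R :> R by rewrite ltr0n.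
set m := mean (Q i); set P := data_law _.
pose Xf (x : #|obs n|.-tuple R) := (n i)%:R * (s * (emp_mean x i - m)).
have mX : measurable_fun setT Xf.
  by apply: measurable_funM => //; exact: measurable_emp_dev.
pose X : {RV P >-> R} := HB.pack Xf (@isMeasurableFun.Build _ _ _ _ Xf mX).
rewrite (_ : [set x | _] = [set x | (n i)%:R * c <= X x]); last first.
  apply/seteqP; split => x /=; rewrite /Xf ler_pM2l//.
(* The parameter [c] is optimal: it minimises [n i * t ^+ 2 / 2 - t * (n i * c)] over [t]. *)
apply: (le_trans (chernoff X ((n i)%:R * c) c0)).
have mgf : ('M_P X c <= (expR ((n i)%:R * (c ^+ 2 / 2)))%:E)%E.
  (* Observations of other arms get the factor 1, so the integrand is a product over all positions
     of the tuple. *)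
  pose f (l : 'I_#|obs n|) (y : R) : R :=
    if tag (enum_val l : obs n) == i then expR (c * s * (y - m)) else 1.
  have -> : 'M_P X c = (\int[P]_x (\prod_l f l (tnth x l))%:E)%E.
    rewrite /mmt_gen_fun unlock; apply: eq_integral => x _ /=.
    congr EFin; rewrite /Xf mulrCA -emp_mean_sub// -big_mkcond /= big_obs.
    rewrite -expR_sum; congr expR.
    rewrite mulrAC [X in X * _]mulrC mulr_sumr mulrC.
    by apply: eq_bigr => j _.
  rewrite integral_product_prob; first last.
  - by move=> l y; rewrite /f; case: (_ == i) => //; exact: expR_ge0.
  - move=> l; rewrite /f; case: (_ == i) => //=.
    by apply: measurableT_comp => //; apply: measurable_funM => //;
      apply: measurable_funB.
  have fE (l : 'I_#|obs n|) : (\int[Q (tag (enum_val l))]_y (f l y)%:E =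
      if tag (enum_val l : obs n) == i then
        'M_(Q i) (fun y : R => y - m)%R (c * s) else 1)%E.
    rewrite /f; case: eqP => [->|_]; last first.
      by rewrite (integral_cst _ _ 1%E)// mul1e; exact: probability_setT.
    rewrite /mmt_gen_fun unlock; apply: eq_integral => y _ /=.
    by rewrite mulrC.
  rewrite (eq_bigr _ (fun l _ => fE l)) -big_mkcond /= big_obs.
  apply: (@le_trans _ _ (\prod_(j < n i) (expR ((c * s) ^+ 2 / 2))%:E)%E).
    have M0 : (0 <= 'M_(Q i) (fun y : R => y - m)%R (c * s))%E.
      rewrite /mmt_gen_fun unlock integral_ge0// => y _.
      by rewrite lee_fin expR_ge0.
    apply: (big_ind2 (fun a b : \bar R => (0 <= a)%E /\ (a <= b)%E) _ _ _).2.
    - by rewrite lee_fin ler01.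
    - by move=> ? ? ? ? [? ?] [? ?]; split; [exact: mule_ge0|exact: lee_pmul].
    - by move=> j _; split => //; exact: sg.
  rewrite prodEFin lee_fin prodr_const card_ord -expRM_natl exprMn s2 mulr1.
  by rewrite mulr_natl.
apply: (le_trans (lee_wpmul2r _ mgf)); first by rewrite lee_fin expR_ge0.
rewrite -EFinM lee_fin -expRD ler_expR.
by rewrite le_eqVlt; apply/orP; left; apply/eqP; field.
Qed.

Lemma measurable_fin_comp d (T : measurableType d) (R : realType) k
    (a : 'I_k -> R) (A : T -> 'I_k) :
  (forall i, measurable (A @^-1` [set i])) ->
  measurable_fun setT (a \o A).
Proof.
move=> mA _ B _; rewrite setTI.
rewrite (_ : _ @^-1` B = \bigcup_(i in [set i | B (a i)]) (A @^-1` [set i])).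
  exact: fin_bigcup_measurable.
apply/seteqP; split => x; first by move=> Bx; exists (A x).
by move=> [i Bi Ai]; have Ei : A x = i by []; rewrite /preimage/= Ei.
Qed.

(** Union bound in integrated form: [Y] is the mean of the selected arm, [b] the best mean, [e] the
    regret tolerated off the bad events [B i]. *)
Lemma expected_shortfall_le d (T : measurableType d) (R : realType)
    (P : probability T R) k (Y : T -> R) (B : 'I_k -> set T) (b e p : R) :
  measurable_fun setT Y -> (forall x, 0 <= Y x) ->
  (forall i, measurable (B i)) -> (forall i, (P (B i) <= p%:E)%E) ->
  0 <= b -> 0 <= e ->
  (forall x, b <= e + \sum_(i < k) \1_(B i) x + Y x) ->
  (b%:E - 'E_P[Y] <= (e + k%:R * p)%:E)%E.
Proof.
move=> mY Y0 mB PB b0 e0 bY.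
have PT : (P [set: T] = 1)%E by exact: probability_setT.
have EY0 : (0 <= 'E_P[Y])%E by exact: expectation_ge0.
(* An infinite expectation makes the left-hand side [-oo]. *)
have [EYfin|] := boolP ('E_P[Y] \is a fin_num)%E; last first.
  by rewrite ge0_fin_numE// -leNgt leye_eq => /eqP ->; rewrite leNye.
rewrite leeBlDr// unlock.
have mS : measurable_fun setT (fun x => \sum_(i < k) (\1_(B i) x : R)).
  by apply: measurable_sum => i; exact: measurable_indic.
have S0 x : 0 <= \sum_(i < k) (\1_(B i) x : R) by apply: sumr_ge0.
apply: (@le_trans _ _
   (\int[P]_x ((e + \sum_(i < k) \1_(B i) x)%:E + (Y x)%:E))%E).
  rewrite -[leLHS]mule1 -PT -integral_cst//.
  apply: ge0_le_integral => //=.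
  - by apply: emeasurable_funD; apply/measurable_EFinP => //;
      exact: measurable_funD.
  - by move=> x _; rewrite -EFinD lee_fin.
rewrite ge0_integralD//; first last.
- exact/measurable_EFinP.
- by move=> x _; rewrite lee_fin.
- by apply/measurable_EFinP; exact: measurable_funD.
- by move=> x _; rewrite lee_fin addr_ge0.
apply: leeD => //; under eq_integral do rewrite EFinD -sumEFin.
rewrite ge0_integralD//; first last.
- apply: emeasurable_sum => i.
  by apply/measurable_EFinP; exact: measurable_indic.
- by move=> x _; rewrite sumEFin lee_fin.
rewrite EFinD; apply: leeD.
  rewrite (integral_cst _ _ e%:E)// -[leRHS]mule1 le_eqVlt; apply/orP; left.
  by apply/eqP; congr (_ * _)%E.
rewrite ge0_integral_sum//; last first.
  by move=> i; apply/measurable_EFinP; exact: measurable_indic.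
rewrite mulr_natl -[in leRHS](card_ord k) -sumr_const -sumEFin.
apply: lee_sum => i _; rewrite integral_indic// setIT; exact: PB.
Qed.

(* The bad event of an arm i <> i0 only involves an overestimate of arm i,
   that of the optimal arm i0 only an underestimate, so k one-sided deviations
   suffice; [dev_sign] selects the side. *)
Definition dev_sign (R : realType) {k : nat} (i0 i : 'I_k) : R :=
  if i == i0 then -1 else 1.

Lemma index_gap_le (R : realType) k (n : 'I_k -> nat) (i0 a : 'I_k)
    (x : #|obs n|.-tuple R) (mu : 'I_k -> R) (alpha beta : R) :
  (1 <= min_count n)%N -> - beta <= alpha <= beta ->
  conf_index alpha x i0 <= conf_index alpha x a ->
  (forall i, dev_sign R i0 i * (emp_mean x i - mu i)
     < beta / Num.sqrt (n i)%:R) ->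
  mu i0 <= 2 * beta / Num.sqrt (min_count n)%:R + mu a.
Proof.
move=> m1 /andP[ab1 ab2] idx dev.
have beta0 : 0 <= beta by lra.
have m0 : 0 < (min_count n)%:R :> R by rewrite ltr0n.
have sV i : (Num.sqrt (n i)%:R)^-1 <= (Num.sqrt (min_count n)%:R)^-1 :> R.
  have le_mn : (min_count n)%:R <= (n i)%:R :> R.
    by rewrite ler_nat min_count_le.
  by rewrite lef_pV2 ?posrE ?sqrtr_gt0 ?ler_sqrt// (lt_le_trans m0).
(* [dev] gives no upper bound on the empirical mean of [i0], so [a = i0] is separate; the gap is
   then zero. *)
have [->|a_neq] := eqVneq a i0.
  by rewrite lerDr divr_ge0 ?sqrtr_ge0// mulr_ge0.
have := dev i0; have := dev a.
rewrite /dev_sign eqxx (negbTE a_neq) => da d0.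
move: idx; rewrite /conf_index => idx.
have b0 : 0 <= beta - alpha by lra.
have ba : 0 <= beta + alpha by lra.
(* Once both inverse roots are bounded by that of the minimum, [alpha] cancels in the sum. *)
have h0 := ler_wpM2l b0 (sV i0).
have ha := ler_wpM2l ba (sV a).
lra.
Qed.

Theorem theorem2 (R : realType) (k : nat) (n : 'I_k -> nat)
    (delta alpha : R) (A : algorithm R k) :
  (1 <= k)%N ->
  (forall i, (1 <= n i)%N) ->
  0 < delta ->
  delta = Num.sqrt (32 * ln (k%:R / delta) / (min_count n)%:R) ->
  (let beta := Num.sqrt (2 * ln (k%:R / delta)) in - beta <= alpha <= beta) ->
  index_algorithm alpha A ->
  (ereal_sup [set simple_regret A theta | theta in Theta n]
     <= (12 * Num.sqrt (ln (k%:R / delta) / (min_count n)%:R))%:E)%E.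
Proof.
move=> k1 n1 d0 dE /=; set L := ln _ in dE *; set beta := Num.sqrt _ => ab idx.
have k0 : 0 < k%:R :> R by rewrite ltr0n.
(* Division by 0 yields 0, so a zero minimum would force [delta = 0]. Likewise [L <= 0] would, as
   the root of a nonpositive number is 0. *)
have m1 : (1 <= min_count n)%N.
  rewrite lt0n; apply/eqP => m0.
  by move: d0; rewrite dE m0 invr0 mulr0 sqrtr0 ltxx.
have m0 : 0 < (min_count n)%:R :> R by rewrite ltr0n.
have L0 : 0 < L.
  have : 0 < 32 * L / (min_count n)%:R by rewrite -sqrtr_gt0 -dE.
  by rewrite pmulr_lgt0 ?invr_gt0// pmulr_rgt0.
have beta0 : 0 < beta by rewrite sqrtr_gt0 mulr_gt0.
have beta2 : beta ^+ 2 = 2 * L by rewrite sqr_sqrtr// mulr_ge0// ltW.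
set q := Num.sqrt (L / (min_count n)%:R).
have q0 : 0 <= q by exact: sqrtr_ge0.
have q2 : q ^+ 2 = L / (min_count n)%:R.
  by rewrite sqr_sqrtr// divr_ge0// ltW.
have d2 : delta ^+ 2 = 32 * q ^+ 2.
  by rewrite dE sqr_sqrtr -?mulrA ?q2// mulrA divr_ge0 ?mulr_ge0// ltW.
have beta_m : beta / Num.sqrt (min_count n)%:R = delta / 4.
  have e0 : 0 <= beta / Num.sqrt (min_count n)%:R.
    by rewrite divr_ge0 ?sqrtr_ge0.
  have f0 : 0 <= delta / 4 by rewrite divr_ge0// ltW.
  (* Both squares equal [2 * q ^+ 2]. *)
  apply/eqP; rewrite -(eqrXn2 (n := 2))//; apply/eqP.
  rewrite !expr_div_n beta2 d2 q2 sqr_sqrtr ?ltW//.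
  by field; rewrite gt_eqF.
have final : delta / 2 + delta <= 12 * q.
  (* This is [32 <= 64] after squaring. *)
  have : delta <= 8 * q.
    rewrite -(ler_pXn2r (n := 2)) ?nnegrE ?(ltW d0) ?mulr_ge0//.
    by rewrite d2 exprMn; nra.
  lra.
apply: ge_ereal_sup => _ [theta [cE _ adm] <-].
(* The type of the data depends on the counts, so they are substituted rather than rewritten. *)
case: theta cE adm => n' Q /= nE adm; subst n'.
set theta := BanditInstance n Q.
have mu01 i : 0 <= arm_mean theta i <= 1 by have [] := adm i.
have mu0 i : 0 <= arm_mean theta i by have /andP[] := mu01 i.
pose j0 : 'I_k := Ordinal k1.
have [i0 _ bestE] := @eq_bigmax _ R 'I_k 0 j0 xpredT (arm_mean theta) isT
  (fun i _ => mu0 i).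
have {}bestE : best_mean theta = arm_mean theta i0 by [].
pose B i : set (#|obs n|.-tuple R) :=
  [set x | beta / Num.sqrt (n i)%:R
           <= dev_sign R i0 i * (emp_mean x i - arm_mean theta i)].
have mB i : measurable (B i).
  rewrite (_ : B i = setT `&` (fun x : #|obs n|.-tuple R =>
      dev_sign R i0 i * (emp_mean x i - arm_mean theta i)) @^-1`
        `[beta / Num.sqrt (n i)%:R, +oo[%classic).
    by apply: measurable_emp_dev => //; exact: measurable_itv.
  by rewrite setTI; apply/seteqP; split => x /=; rewrite in_itv/= andbT.
have PB i : (data_law theta (B i) <= (delta / k%:R)%:E)%E.
  have [_ _ sg] := adm i.
  have ni0 : 0 < (n i)%:R :> R by rewrite ltr0n.
  apply: le_trans (emp_mean_tail R k theta i _ _ (n1 i) sg _ _) _.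
  - by rewrite /dev_sign; case: ifP => _; rewrite ?sqrrN expr1n.
  - by rewrite divr_gt0// sqrtr_gt0.
  rewrite lee_fin /= expr_div_n beta2 sqr_sqrtr ?(ltW ni0)//.
  (* The choice of [beta] makes the exponent [- L], and [expR (- L)] is [delta / k]. *)
  rewrite (_ : _ / 2 = L); last by field; rewrite gt_eqF.
  by rewrite expRN lnK ?posrE ?divr_gt0// invf_div.
rewrite /simple_regret.
apply: (@le_trans _ _ (delta / 2 + k%:R * (delta / k%:R))%:E); last first.
  by rewrite lee_fin [k%:R * _]mulrC divfK ?gt_eqF.
apply: (expected_shortfall_le _ _ _ (data_law theta) k _ B).
- by apply: measurable_fin_comp => i; exact: measurable_select.
- by move=> x.
- exact: mB.
- exact: PB.
- by rewrite bestE.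
- by rewrite divr_ge0// ltW.
move=> x; rewrite bestE.
(* On a bad event a single indicator already covers the best mean, which is at most 1. *)
have [[i Bi]|noB] := pselect (exists i, B i x).
  rewrite (bigD1 i)//= indicE mem_set//= mulr1n.
  have /andP[_ le1] := mu01 i0.
  have := mu0 (A n x).
  have : 0 <= \sum_(j < k | j != i) (\1_(B j) x : R) by apply: sumr_ge0.
  lra.
rewrite big1 ?addr0; last first.
  by move=> i _; rewrite indicE memNset// => Bi; apply: noB; exists i.
have -> : delta / 2 = 2 * beta / Num.sqrt (min_count n)%:R.
  by rewrite -mulrA beta_m; field.
apply: (index_gap_le _ _ _ _ _ x _ alpha) => //.
  exact: idx.
by move=> i; rewrite ltNge; apply/negP => Bi; apply: noB; exists i.
Qed.
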